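(* Let $x_0,x_1\in\mathbb C$, set $\mathbf x^\delta=x_0x_1$, and let $u\in\mathbb C$; assume $x_0,x_1,u\neq0$, $|\mathbf x^\delta|<1$, and that none of the denominators below vanishes. Then $$\sum_{n\in\mathbb Z}u^nx_0^{\frac{n(n+1)}2}x_1^{\frac{n(n-1)}2}\frac{(u^{-1}x_0;\mathbf x^\delta)_n}{(ux_0;\mathbf x^\delta)_n}=\frac{(u^2\mathbf x^\delta;\mathbf x^{2\delta})_\infty(x_0^2;\mathbf x^{2\delta})_\infty(x_1^2;\mathbf x^{2\delta})_\infty(\mathbf x^{2\delta};\mathbf x^{2\delta})_\infty}{(ux_0;\mathbf x^\delta)_\infty(ux_1;\mathbf x^\delta)_\infty}.$$
   Context: $\mathbf x^{2\delta}=(x_0x_1)^2$. $(a;b)_\infty=\prod_{k\ge0}(1-ab^k)$; for $n\ge0$, $(a;b)_n=\prod_{k=0}^{n-1}(1-ab^k)$; for $n>0$, $(a;b)_{-n}=\dfrac{(-b/a)^n\,b^{n(n-1)/2}}{(b/a;b)_n}$, and for $n<0$ the quotient $\frac{(u^{-1}x_0;\mathbf x^\delta)_n}{(ux_0;\mathbf x^\delta)_n}$ is interpreted by this formula after cancellation, i.e. with $N=-n$ and $\mathbf{x}^\delta=b$, as $u^{2N}\frac{(bu^{-1}/x_0;b)_N}{(bu/x_0;b)_N}$, where $b/x_0=x_1$. *)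

(* Defs.v *)
From Stdlib Require Import Reals ZArith.
From Coquelicot Require Import Coquelicot.

Open Scope C_scope.

Definition Cpowz (z : C) (n : Z) : C :=
  match n with
  | Z0 => 1
  | Zpos p => z ^ Pos.to_nat p
  | Zneg p => / (z ^ Pos.to_nat p)
  end.

(* (a;b)_n for n >= 0 *)
Fixpoint qpoch (a b : C) (n : nat) : C :=
  match n with
  | O => 1
  | S k => qpoch a b k * (1 - a * b ^ k)
  end.

(* (a;b)_oo; the limit of the partial products exists when |b| < 1, and
   [qpoch_inf_unique] identifies it with the value of this total function. *)
Definition qpoch_inf (a b : C) : C :=
  @lim C_CompleteNormedModule (filtermap (qpoch a b) eventually).

(* (a;b)_n for n in Z; the exponent N (N - 1) / 2 is a natural number. *)
Definition qpochZ (a b : C) (n : Z) : C :=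
  match n with
  | Z0 => 1
  | Zpos p => qpoch a b (Pos.to_nat p)
  | Zneg p =>
      let N := Pos.to_nat p in
      (- (b / a)) ^ N * b ^ (N * (N - 1) / 2) / qpoch (b / a) b N
  end.

(* The quotient (a;b)_n / (c;b)_n. For n = -N < 0 the common factors
   (-b)^N b^(N(N-1)/2) are cancelled, so that a zero of (b/c;b)_N is a zero of
   the quotient rather than a pole of its denominator. With a = x0/u,
   c = u x0 and b = x0 x1 the negative case reads
   u^(2N) (x1/u;b)_N / (u x1;b)_N; see [qpoch_quot_neg]. *)
Definition qpoch_quot (a c b : C) (n : Z) : C :=
  match n with
  | Z0 => 1
  | Zpos p => qpoch a b (Pos.to_nat p) / qpoch c b (Pos.to_nat p)
  | Zneg p =>
      let N := Pos.to_nat p in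
      (c / a) ^ N * qpoch (b / c) b N / qpoch (b / a) b N
  end.

(* Absolutely convergent sum over Z, so that no summation order is implied. *)
Definition is_seriesZ (f : Z -> C) (s : C) : Prop :=
  ex_series (fun n : nat => Cmod (f (Z.of_nat n))) /\
  ex_series (fun n : nat => Cmod (f (- Z.of_nat (S n))%Z)) /\
  exists sp sn : C,
    is_series (fun n : nat => f (Z.of_nat n)) sp /\
    is_series (fun n : nat => f (- Z.of_nat (S n))%Z) sn /\
    s = sp + sn.

Lemma qpoch_inf_unique (a b l : C) :
  filterlim (qpoch a b) eventually (locally l) -> qpoch_inf a b = l.
Proof.
intros H.
assert (FF : ProperFilter (filtermap (qpoch a b) eventually))
  by apply filtermap_proper_filter, eventually_filter.
refine (@filterlim_locally_unique _ C_AbsRing C_NormedModule eventually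
          (Proper_StrongProper _ eventually_filter) (qpoch a b) _ _ _ H).
refine (proj2 (@filterlim_locally _ C_UniformSpace eventually _ _ _) _).
intros eps.
refine (@complete_cauchy C_CompleteNormedModule
          (filtermap (qpoch a b) eventually) FF _ eps).
intros e; exists l.
exact (proj1 (@filterlim_locally _ C_UniformSpace eventually _ _ _) H e).
Qed.

Lemma qpoch_quotE (a c b : C) (n : Z) :
  a <> 0 -> c <> 0 -> b <> 0 ->
  (forall N : nat, qpoch (b / a) b N <> 0) ->
  (forall N : nat, qpoch (b / c) b N <> 0) ->
  qpoch_quot a c b n = qpochZ a b n / qpochZ c b n.
Proof.
intros ha hc hb hA hC.
destruct n as [|p|p]; simpl.
- now field.
- reflexivity.
- set (N := Pos.to_nat p).
  assert (E : (- (b / a)) = (- (b / c)) * (c / a)) by (field; auto).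
  rewrite E, Cpow_mult_l.
  assert (n1 : (- (b / c)) ^ N <> 0).
  { apply Cpow_nz. intros h. apply hb.
    replace b with (- (- (b / c)) * c) by (field; auto).
    rewrite h; ring. }
  assert (n2 : b ^ (N * (N - 1) / 2) <> 0) by (apply Cpow_nz; auto).
  field; repeat split; auto.
Qed.

Lemma qpoch_quot_neg (x0 x1 u : C) (p : positive) :
  x0 <> 0 -> u <> 0 ->
  let N := Pos.to_nat p in
  qpoch_quot (/ u * x0) (u * x0) (x0 * x1) (Zneg p) =
  u ^ (2 * N) * qpoch (/ u * x1) (x0 * x1) N / qpoch (u * x1) (x0 * x1) N.
Proof.
intros h0 hu N; unfold qpoch_quot; fold N.
replace (u * x0 / (/ u * x0)) with (u ^ 2) by (simpl; field; auto).
replace (x0 * x1 / (u * x0)) with (/ u * x1) by (field; auto).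
replace (x0 * x1 / (/ u * x0)) with (u * x1) by (field; auto).
now rewrite Cpow_mult_r.
Qed.

(* Main.v *)
(* With q = x0 x1, write T x n for the product over k < n of
   q^k x (u - x q^k) / (1 - u x q^k). The summand of index n >= 0 is T x0 n and
   that of index -n is T x1 n, so the bilateral sum S u is symmetric in x0, x1.
   Telescoping gives (1 - u x0) (1 - u x1) S u = (1 - u^2 q) S (u q). Iterating
   and letting u q^m tend to 0 under a dominated convergence bound,
   S u = (u^2 q; q^2)_oo / ((u x0; q)_oo (u x1; q)_oo) * S 0, and S 0 is the theta
   series of the Jacobi triple product with base q^2. The latter is the limit of
   its finite form, whose coefficients are the q-binomials [2N choose N + n]. *)

Require Import Defs.
From Stdlib Require Import Reals ZArith Lra Lia IndefiniteDescription.
From Coquelicot Require Import Coquelicot.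
Open Scope C_scope.

(** * Limits and series of complex numbers *)

(** The two halves of the bilateral sum are kept apart, as series over [nat] that start at index 1,
    and each is related separately to its value at u q. A half alone does not simply scale:
    telescoping leaves the boundary term u x (1 - u y). The two boundary terms and the central
    summand 1 recombine through (1 - u x)(1 - u y) + u x (1 - u y) + u y (1 - u x) = 1 - u^2 q. At u
    q^m the right side is 1 - u^2 q q^(2m), which is why the base q^2 appears in the result although
    the summands have base q. At u = 0 the factors of a half become -x^2 q^(2k), and x0^2 x1^2 = q^2
    is exactly the relation a b = Q that the triple product requires. The finite triple product
    follows the same pattern, with the step from N to N + 1 in place of the step from u to u q. The
    domination is uniform in m because the denominators at u q^m are among those at u, and these
    stay away from 0. *)

Definition Clim (s : nat -> C) (l : C) : Prop :=
  is_lim_seq (fun n => Cmod (s n - l)) (Finite 0%R).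

(** Bridge to filters. Convergence is measured by real distances elsewhere, so that the limit
    arithmetic of real sequences applies. *)
Lemma Clim_filterlim (s : nat -> C) (l : C) :
  Clim s l <-> filterlim s eventually (locally l).
Proof.
split; intros H.
- apply (proj2 (@filterlim_locally_ball_norm C_AbsRing nat C_NormedModule
    eventually _ s l)).
  intros eps; apply is_lim_seq_spec in H.
  destruct (H eps) as [N HN]; exists N; intros n hn.
  specialize (HN n hn); rewrite Rminus_0_r, Rabs_pos_eq in HN by apply Cmod_ge_0.
  exact HN.
- apply is_lim_seq_spec; intros eps.
  destruct (proj1 (@filterlim_locally_ball_norm C_AbsRing nat C_NormedModule
    eventually _ s l) H eps) as [N HN].
  exists N; intros n hn.
  rewrite Rminus_0_r, Rabs_pos_eq by apply Cmod_ge_0.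
  exact (HN n hn).
Qed.

Lemma Clim_squeeze (s : nat -> C) (l : C) (r : nat -> R) :
  (forall n, (Cmod (s n - l) <= r n)%R) -> is_lim_seq r (Finite 0%R) -> Clim s l.
Proof.
intros H Hr.
apply (is_lim_seq_le_le (fun _ => 0%R) _ r).
- intros n; split; [apply Cmod_ge_0|apply H].
- apply is_lim_seq_const.
- exact Hr.
Qed.

Lemma Clim_ext (s t : nat -> C) (l : C) :
  (forall n, s n = t n) -> Clim s l -> Clim t l.
Proof.
intros E; apply is_lim_seq_ext; intros n; now rewrite E.
Qed.

Lemma Clim_const (c : C) : Clim (fun _ => c) c.
Proof.
apply (Clim_squeeze _ _ (fun _ => 0%R)); [|apply is_lim_seq_const].
intros _; unfold Cminus; rewrite Cplus_opp_r, Cmod_0; apply Rle_refl.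
Qed.

Lemma Clim_plus (s t : nat -> C) (a b : C) :
  Clim s a -> Clim t b -> Clim (fun n => s n + t n) (a + b).
Proof.
intros Hs Ht.
apply (Clim_squeeze _ _ (fun n => (Cmod (s n - a) + Cmod (t n - b))%R)).
- intros n; replace (s n + t n - (a + b)) with ((s n - a) + (t n - b)) by ring.
  apply Cmod_triangle.
- replace 0%R with (0 + 0)%R by ring; now apply is_lim_seq_plus'.
Qed.

Lemma Clim_mult (s t : nat -> C) (a b : C) :
  Clim s a -> Clim t b -> Clim (fun n => s n * t n) (a * b).
Proof.
intros Hs Ht.
apply (Clim_squeeze _ _ (fun n => (Cmod (s n - a) * Cmod (t n - b)
  + (Cmod a * Cmod (t n - b) + Cmod b * Cmod (s n - a)))%R)).
- intros n; replace (s n * t n - a * b) with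
    ((s n - a) * (t n - b) + (a * (t n - b) + b * (s n - a))) by ring.
  rewrite <- !Cmod_mult.
  eapply Rle_trans; [apply Cmod_triangle|].
  apply Rplus_le_compat_l, Cmod_triangle.
- replace 0%R with (0 * 0 + (Cmod a * 0 + Cmod b * 0))%R by ring.
  apply is_lim_seq_plus'; [now apply is_lim_seq_mult'|].
  apply is_lim_seq_plus'; apply is_lim_seq_mult'; auto; apply is_lim_seq_const.
Qed.

Lemma Clim_minus (s t : nat -> C) (a b : C) :
  Clim s a -> Clim t b -> Clim (fun n => s n - t n) (a - b).
Proof.
intros Hs Ht; replace (a - b) with (a + (- (1)) * b) by ring.
apply (Clim_ext (fun n => s n + (- (1)) * t n)); [intros n; ring|].
apply Clim_plus; [exact Hs|].
apply Clim_mult; [apply Clim_const|exact Ht].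
Qed.

Lemma Clim_unique (s : nat -> C) (a b : C) : Clim s a -> Clim s b -> a = b.
Proof.
intros Ha Hb; apply Ceq_minus.
assert (H := Clim_minus _ _ _ _ Ha Hb).
apply (is_lim_seq_ext _ (fun _ => Cmod (a - b))) in H.
- apply is_lim_seq_unique in H; rewrite Lim_seq_const in H.
  injection H; apply Cmod_eq_0.
- intros n; rewrite <- (Cmod_opp (a - b)); f_equal; ring.
Qed.

Lemma Clim_incr_n (s : nat -> C) (k : nat) (l : C) :
  Clim s l -> Clim (fun n => s (n + k)%nat) l.
Proof. exact (proj1 (is_lim_seq_incr_n _ k _)). Qed.

Lemma Clim_Cmod (s : nat -> C) (l : C) :
  Clim s l -> is_lim_seq (fun n => Cmod (s n)) (Finite (Cmod l)).
Proof.
intros H.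
apply (is_lim_seq_le_le (fun n => (Cmod l - Cmod (s n - l))%R) _
                        (fun n => (Cmod l + Cmod (s n - l))%R)).
- intros n; split.
  + assert (h := Cmod_triangle (s n) (- (s n - l))).
    replace (s n + - (s n - l)) with l in h by ring.
    rewrite Cmod_opp in h; lra.
  + assert (h := Cmod_triangle l (s n - l)).
    replace (l + (s n - l)) with (s n) in h by ring; lra.
- replace (Cmod l) with (Cmod l - 0)%R at 1 by ring.
  apply is_lim_seq_minus'; [apply is_lim_seq_const|exact H].
- replace (Cmod l) with (Cmod l + 0)%R at 1 by ring.
  apply is_lim_seq_plus'; [apply is_lim_seq_const|exact H].
Qed.

Lemma Clim_inv (s : nat -> C) (l : C) :
  (forall n, s n <> 0) -> l <> 0 -> Clim s l -> Clim (fun n => / s n) (/ l).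
Proof.
intros Hs Hl H.
assert (l0 : Cmod l <> 0%R) by now apply Rgt_not_eq, Cmod_gt_0.
apply (Clim_squeeze _ _ (fun n => (Cmod (s n - l) * (/ Cmod (s n) * / Cmod l))%R)).
- intros n; right.
  replace (/ s n - / l) with (- ((s n - l) * (/ s n * / l)))
    by (field; split; auto).
  now rewrite Cmod_opp, !Cmod_mult, !Cmod_inv.
- replace 0%R with (0 * (/ Cmod l * / Cmod l))%R by ring.
  apply is_lim_seq_mult'; [exact H|].
  apply is_lim_seq_mult'; [|apply is_lim_seq_const].
  apply (is_lim_seq_inv _ (Finite (Cmod l))); [now apply Clim_Cmod|].
  intros h; injection h; exact l0.
Qed.

Lemma is_lim_seq_bounded (r : nat -> R) (l : R) :
  is_lim_seq r (Finite l) -> exists M, forall n, (Rabs (r n) <= M)%R.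
Proof.
intros H; apply is_lim_seq_Reals in H.
destruct (maj_by_pos r (exist _ l H)) as [M [_ HM]]; now exists M.
Qed.

Lemma Clim_bounded (s : nat -> C) (l : C) :
  Clim s l -> exists M, forall n, (Cmod (s n) <= M)%R.
Proof.
intros H; destruct (is_lim_seq_bounded _ _ (Clim_Cmod _ _ H)) as [M HM].
exists M; intros n; specialize (HM n).
now rewrite Rabs_pos_eq in HM by apply Cmod_ge_0.
Qed.

(** * Complex series and dominated convergence *)

Notation Csum := (@sum_n (NormedModule.AbelianMonoid C_AbsRing C_NormedModule)).
Notation is_Cseries := (@is_series C_AbsRing C_NormedModule).

Lemma Csum_Sn (f : nat -> C) (n : nat) : Csum f (S n) = Csum f n + f (S n).
Proof. apply (@sum_Sn (NormedModule.AbelianMonoid C_AbsRing C_NormedModule)). Qed.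

Lemma is_series_Clim (f : nat -> C) (l : C) : is_Cseries f l <-> Clim (Csum f) l.
Proof. symmetry; apply Clim_filterlim. Qed.

Lemma is_Cseries_unique (f : nat -> C) (l l' : C) :
  is_Cseries f l -> is_Cseries f l' -> l = l'.
Proof. rewrite !is_series_Clim; apply Clim_unique. Qed.

(** Both recurrences of the proof, in [N] for the finite triple product and in [u] for the bilateral
    sum, rest on this with an explicit [H], called a flux below. *)
Lemma is_Cseries_telescope (f H : nat -> C) (l : C) :
  (forall n, f n = H (S n) - H n) -> Clim H l -> is_Cseries f (l - H O).
Proof.
intros Hf HH; apply is_series_Clim.
apply (Clim_ext (fun n => H (S n) - H O)).
- induction n as [|n IH].
  + rewrite sum_O, Hf; reflexivity.
  + rewrite Csum_Sn, <- IH, Hf; ring.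
- apply Clim_minus; [|apply Clim_const].
  apply (Clim_ext (fun n => H (n + 1)%nat)); [intros n; f_equal; lia|].
  now apply Clim_incr_n.
Qed.

Lemma ex_series_Cmod (f : nat -> C) :
  ex_series (fun n => Cmod (f n)) -> exists l : C, is_Cseries f l.
Proof.
intros H.
apply (@ex_series_le C_AbsRing C_CompleteNormedModule f (fun n => Cmod (f n))); auto.
intros n; apply Rle_refl.
Qed.

Lemma Cmod_series_le (f : nat -> C) (l : C) (r : nat -> R) :
  is_Cseries f l ->
  (forall n, (Cmod (f n) <= r n)%R) -> ex_series r -> (Cmod l <= Series r)%R.
Proof.
intros Hf Hr Er.
assert (L : is_lim_seq (sum_n r) (Finite (Series r))) by exact (Series_correct r Er).
assert (L' := Clim_Cmod _ _ (proj1 (is_series_Clim f l) Hf)).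
assert (H : Rbar_le (Finite (Cmod l)) (Finite (Series r))); [|exact H].
refine (is_lim_seq_le _ _ _ _ _ L' L).
intros n.
eapply Rle_trans; [exact (@norm_sum_n_m C_AbsRing C_NormedModule f 0 n)|].
apply sum_n_m_le; exact Hr.
Qed.

Lemma is_lim_seq_sum_n_0 (d : nat -> nat -> R) (K : nat) :
  (forall n, is_lim_seq (fun m => d m n) (Finite 0%R)) ->
  is_lim_seq (fun m => sum_n (d m) K) (Finite 0%R).
Proof.
intros H; induction K as [|K IH].
- apply (is_lim_seq_ext (fun m => d m O)); [|apply H].
  intros m; now rewrite sum_O.
- apply (is_lim_seq_ext (fun m => (sum_n (d m) K + d m (S K))%R)).
  + intros m; now rewrite sum_Sn.
  + replace 0%R with (0 + 0)%R by ring; now apply is_lim_seq_plus'.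
Qed.

Lemma Series_dominated_0 (d : nat -> nat -> R) (M : nat -> R) :
  (forall m n, (0 <= d m n <= M n)%R) -> ex_series M ->
  (forall n, is_lim_seq (fun m => d m n) (Finite 0%R)) ->
  is_lim_seq (fun m => Series (d m)) (Finite 0%R).
Proof.
intros Hd HM H0; apply is_lim_seq_spec; intros eps.
assert (e2 : (0 < eps / 2)%R) by (destruct eps; simpl; lra).
assert (Ed : forall m, ex_series (d m)).
{ intros m; apply (@ex_series_le R_AbsRing R_CompleteNormedModule _ M); auto.
  intros n; change (Rabs (d m n) <= M n)%R.
  rewrite Rabs_pos_eq; apply Hd. }
assert (LM : is_lim_seq (sum_n M) (Finite (Series M))) by exact (Series_correct M HM).
(* [K] makes the tail of [M] smaller than eps/2, for all [m] at once; [m0] then makes the sum of the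
   terms up to index [K] smaller than eps/2. *)
apply is_lim_seq_spec in LM; destruct (LM (mkposreal _ e2)) as [K HK].
specialize (HK K (le_n K)); simpl in HK.
assert (L0 := is_lim_seq_sum_n_0 d K H0).
apply is_lim_seq_spec in L0; destruct (L0 (mkposreal _ e2)) as [m0 Hm0].
exists m0; intros m hm; specialize (Hm0 m hm); simpl in Hm0.
rewrite Rminus_0_r in *.
assert (pos : (0 <= Series (d m))%R).
{ replace 0%R with (Series (fun n => 0 * d m n)%R) by (rewrite Series_scal_l; ring).
  apply Series_le; auto; intros n; rewrite Rmult_0_l; split; [lra|apply Hd]. }
rewrite Rabs_pos_eq by exact pos.
rewrite (Series_incr_n _ (S K)) by (auto; lia).
rewrite (Series_incr_n M (S K)) in HK by (auto; lia).
rewrite <- !sum_n_Reals in *; simpl pred in *.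
assert (T : (Series (fun k => d m (S K + k)%nat) <= Series (fun k => M (S K + k)%nat))%R).
{ apply Series_le; [intros; apply Hd|].
  now apply ex_series_incr_n. }
apply Rabs_def2 in HK; apply Rabs_def2 in Hm0; lra.
Qed.

Lemma series_dominated_convergence (f : nat -> nat -> C) (g : nat -> C)
    (s : nat -> C) (l : C) (M : nat -> R) :
  (forall m n, (Cmod (f m n) <= M n)%R) -> ex_series M ->
  (forall n, Clim (fun m => f m n) (g n)) ->
  (forall m, is_Cseries (f m) (s m)) ->
  is_Cseries g l ->
  Clim s l.
Proof.
intros Hf HM Hg Hs Hl.
assert (Bg : forall n, (Cmod (g n) <= M n)%R).
{ intros n.
  assert (H : Rbar_le (Finite (Cmod (g n))) (Finite (M n))); [|exact H].
  refine (is_lim_seq_le _ _ _ _ _ (Clim_Cmod _ _ (Hg n)) (is_lim_seq_const (M n))).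
  intros m; apply Hf. }
(* The pointwise limit inherits the bound [M n], so the differences are dominated by twice the
   majorant. *)
assert (E2 : ex_series (fun n => (2 * M n)%R)).
{ exact (@ex_series_scal R_AbsRing R_NormedModule 2%R M HM). }
assert (B2 : forall m n, (Cmod (f m n - g n) <= 2 * M n)%R).
{ intros m n; unfold Cminus; eapply Rle_trans; [apply Cmod_triangle|].
  rewrite Cmod_opp; specialize (Hf m n); specialize (Bg n); lra. }
apply (Clim_squeeze _ _ (fun m => Series (fun n => Cmod (f m n - g n)))).
- intros m.
  apply (Cmod_series_le (fun n => f m n - g n)).
  + exact (@is_series_minus C_AbsRing C_NormedModule _ _ _ _ (Hs m) Hl).
  + intros n; apply Rle_refl.
  + apply (@ex_series_le R_AbsRing R_CompleteNormedModule _ _) with (2 := E2).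
    intros n; change (Rabs (Cmod (f m n - g n)) <= 2 * M n)%R.
    rewrite Rabs_pos_eq by apply Cmod_ge_0; apply B2.
- apply (Series_dominated_0 (fun m n => Cmod (f m n - g n)) (fun n => (2 * M n)%R)); auto.
  intros m n; split; [apply Cmod_ge_0|apply B2].
Qed.

(** * Infinite products *)

Lemma Rpow_unit (r : R) (n : nat) : (0 <= r < 1)%R -> (0 <= r ^ n <= 1)%R.
Proof.
intros H; split; [now apply pow_le|].
rewrite <- (pow1 n); apply pow_incr; lra.
Qed.

(* [|p n| <= exp (K (1 + r + ... + r^(n-1))) <= exp (K / (1 - r))] *)
Lemma product_bounded (p : nat -> C) (K r : R) :
  (0 <= r < 1)%R -> (0 <= K)%R ->
  (forall n, (Cmod (p (S n)) <= Cmod (p n) * (1 + K * r ^ n))%R) ->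
  forall n, (Cmod (p n) <= Cmod (p O) * exp (K / (1 - r)))%R.
Proof.
intros Hr HK Hp.
assert (B : forall n,
  (Cmod (p n) <= Cmod (p O) * exp (K / (1 - r) * (1 - r ^ n)))%R).
{ induction n as [|n IH].
  - simpl; rewrite Rminus_diag, Rmult_0_r, exp_0; lra.
  - replace (K / (1 - r) * (1 - r ^ S n))%R
      with (K / (1 - r) * (1 - r ^ n) + K * r ^ n)%R by (simpl; field; lra).
    rewrite exp_plus, <- Rmult_assoc.
    eapply Rle_trans; [apply Hp|].
    assert (Kr : (0 <= K * r ^ n)%R) by (apply Rmult_le_pos; [|apply Rpow_unit]; lra).
    apply Rmult_le_compat; [apply Cmod_ge_0|lra|exact IH|].
    apply exp_ineq1_le. }
intros n; eapply Rle_trans; [apply B|].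
apply Rmult_le_compat_l; [apply Cmod_ge_0|].
assert (H : (K / (1 - r) * (1 - r ^ n) <= K / (1 - r))%R).
{ assert (0 <= K / (1 - r))%R by (apply Rdiv_le_0_compat; lra).
  assert (h := Rpow_unit r n Hr); nra. }
destruct H as [H|H]; [left; now apply exp_increasing|rewrite H; apply Rle_refl].
Qed.

Lemma Clim_geometric_increments (p : nat -> C) (K r : R) :
  (0 <= r < 1)%R ->
  (forall n, (Cmod (p (S n) - p n) <= K * r ^ n)%R) ->
  exists l, Clim p l.
Proof.
intros Hr Hp.
destruct (ex_series_Cmod (fun n => p (S n) - p n)) as [l Hl].
{ apply (@ex_series_le R_AbsRing R_CompleteNormedModule _ (fun n => (K * r ^ n)%R)).
  - intros n; change (Rabs (Cmod (p (S n) - p n)) <= K * r ^ n)%R.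
    rewrite Rabs_pos_eq by apply Cmod_ge_0; apply Hp.
  - apply (@ex_series_scal R_AbsRing R_NormedModule K), ex_series_geom.
    rewrite Rabs_pos_eq; lra. }
apply is_series_Clim in Hl.
exists (l + p O).
apply (is_lim_seq_incr_1 (fun n => Cmod (p n - (l + p O)))).
change (Clim (fun n => p (S n)) (l + p O)).
apply (Clim_ext (fun n => Csum (fun n => p (S n) - p n) n + p O)).
- induction n as [|n IH].
  + rewrite sum_O; ring.
  + rewrite Csum_Sn.
    replace (p (S (S n))) with (p (S n) + (p (S (S n)) - p (S n))) by ring.
    rewrite <- IH; ring.
- apply Clim_plus; [exact Hl|apply Clim_const].
Qed.

(** The partial products are bounded, so their increments [p n * e n] decay geometrically. *)
Lemma product_Clim (p e : nat -> C) (K r : R) :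
  (0 <= r < 1)%R -> (0 <= K)%R ->
  (forall n, p (S n) = p n * (1 + e n)) ->
  (forall n, (Cmod (e n) <= K * r ^ n)%R) ->
  exists l, Clim p l.
Proof.
intros Hr HK Hp He.
assert (B := product_bounded p K r Hr HK).
apply (Clim_geometric_increments p (Cmod (p O) * exp (K / (1 - r)) * K)%R r Hr).
intros n; rewrite Hp.
replace (p n * (1 + e n) - p n) with (p n * e n) by ring.
rewrite Cmod_mult, Rmult_assoc.
apply Rmult_le_compat; try apply Cmod_ge_0; [|apply He].
apply B; clear n; intros n; rewrite Hp, Cmod_mult.
apply Rmult_le_compat_l; [apply Cmod_ge_0|].
eapply Rle_trans; [apply Cmod_triangle|]; rewrite Cmod_1; specialize (He n); lra.
Qed.

Lemma qpoch_factor_nz (a b : C) (k : nat) :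
  (forall n, qpoch a b n <> 0) -> 1 - a * b ^ k <> 0.
Proof.
intros H h; apply (H (S k)); simpl; rewrite h; ring.
Qed.

Lemma qpoch_Clim (a b : C) :
  (Cmod b < 1)%R -> Clim (qpoch a b) (qpoch_inf a b).
Proof.
intros Hb.
destruct (product_Clim (qpoch a b) (fun n => - (a * b ^ n)) (Cmod a) (Cmod b))
  as [l Hl].
- split; [apply Cmod_ge_0|exact Hb].
- apply Cmod_ge_0.
- intros n; reflexivity.
- intros n; rewrite Cmod_opp, Cmod_mult, Cmod_pow; apply Rle_refl.
- now rewrite (qpoch_inf_unique a b l (proj1 (Clim_filterlim _ _) Hl)).
Qed.

Lemma Cpow_Clim_0 (b : C) : (Cmod b < 1)%R -> Clim (fun n => b ^ n) 0.
Proof.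
intros Hb; apply (Clim_squeeze _ _ (fun n => (Cmod b ^ n)%R)).
- intros n; rewrite <- Cmod_pow; right; f_equal; ring.
- apply is_lim_seq_geom; rewrite Rabs_pos_eq; [exact Hb|apply Cmod_ge_0].
Qed.

(** The factors tend to 1 and none is 0, so their inverses converge and are bounded by some [M];
    then [d] is [/ M]. *)
Lemma qpoch_factor_lower_bound (a b : C) :
  (Cmod b < 1)%R -> (forall n, qpoch a b n <> 0) ->
  exists d, (0 < d)%R /\ forall k, (d <= Cmod (1 - a * b ^ k))%R.
Proof.
intros Hb Hnz.
assert (nz := fun k => qpoch_factor_nz a b k Hnz).
assert (L : Clim (fun k => / (1 - a * b ^ k)) (/ (1 - a * 0))).
{ apply Clim_inv; [exact nz| |].
  - rewrite Cmult_0_r; unfold Cminus; rewrite Copp_0, Cplus_0_r; apply C1_nz.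
  - apply Clim_minus; [apply Clim_const|].
    apply Clim_mult; [apply Clim_const|now apply Cpow_Clim_0]. }
destruct (Clim_bounded _ _ L) as [M HM].
assert (P : forall k, (0 < Cmod (1 - a * b ^ k))%R).
{ intros k; now apply Cmod_gt_0. }
assert (M0 : (0 < M)%R).
{ eapply Rlt_le_trans; [|apply (HM O)].
  rewrite Cmod_inv by apply nz; apply Rinv_0_lt_compat, P. }
exists (/ M)%R; split; [now apply Rinv_0_lt_compat|].
intros k; rewrite <- (Rinv_inv (Cmod (1 - a * b ^ k))).
apply Rinv_le_contravar; [apply Rinv_0_lt_compat, P|].
rewrite <- Cmod_inv by apply nz; apply HM.
Qed.

(** The inverses are again partial products of the form 1 + e, since 1/(1 - z) = 1 + z/(1 - z) with
    z = a b^n; the lower bound [d] on the factors keeps e geometrically small. *)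
Lemma Cinv_qpoch_Clim (a b : C) :
  (Cmod b < 1)%R -> (forall n, qpoch a b n <> 0) ->
  exists l, Clim (fun n => / qpoch a b n) l.
Proof.
intros Hb Hnz.
destruct (qpoch_factor_lower_bound a b Hb Hnz) as [d [d0 Hd]].
apply (product_Clim _ (fun n => a * b ^ n / (1 - a * b ^ n)) (Cmod a / d)%R (Cmod b)).
- split; [apply Cmod_ge_0|exact Hb].
- apply Rdiv_le_0_compat; [apply Cmod_ge_0|exact d0].
- intros n; assert (h := qpoch_factor_nz a b n Hnz); simpl.
  field; split; [exact h|apply Hnz].
- intros n; rewrite Cmod_div by now apply qpoch_factor_nz.
  rewrite Cmod_mult, Cmod_pow; unfold Rdiv.
  replace (Cmod a * / d * Cmod b ^ n)%R with (Cmod a * Cmod b ^ n * / d)%R by ring.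
  apply Rmult_le_compat_l.
  + apply Rmult_le_pos; [|apply pow_le]; apply Cmod_ge_0.
  + apply Rinv_le_contravar; [exact d0|apply Hd].
Qed.

(** The partial products and their inverses both converge, and the two limits multiply to 1. *)
Lemma qpoch_inf_nz (a b : C) :
  (Cmod b < 1)%R -> (forall n, qpoch a b n <> 0) -> qpoch_inf a b <> 0.
Proof.
intros Hb Hnz h.
destruct (Cinv_qpoch_Clim a b Hb Hnz) as [l Hl].
assert (H := Clim_mult _ _ _ _ (qpoch_Clim a b Hb) Hl).
apply (Clim_ext _ (fun _ => 1)) in H; [|intros n; now apply Cinv_r].
assert (E := Clim_unique _ _ _ (Clim_const 1) H).
rewrite h, Cmult_0_l in E; now apply C1_nz.
Qed.

Lemma Cinv_qpoch_Clim_inf (a b : C) :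
  (Cmod b < 1)%R -> (forall n, qpoch a b n <> 0) ->
  Clim (fun n => / qpoch a b n) (/ qpoch_inf a b).
Proof.
intros Hb Hnz.
apply Clim_inv; [exact Hnz|now apply qpoch_inf_nz|now apply qpoch_Clim].
Qed.

(* [K^n r^(n(n-1)/2)] *)
Fixpoint gauss_majorant (K r : R) (n : nat) : R :=
  match n with
  | O => 1
  | S k => gauss_majorant K r k * (K * r ^ k)
  end.

Lemma gauss_majorant_pos (K r : R) (n : nat) :
  (0 < K)%R -> (0 < r)%R -> (0 < gauss_majorant K r n)%R.
Proof.
intros HK Hr; induction n as [|n IH]; simpl; [lra|].
repeat apply Rmult_lt_0_compat; auto; now apply pow_lt.
Qed.

(** Consecutive terms have ratio [K * r ^ n], which tends to 0 however large [K] is. *)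
Lemma ex_series_gauss_majorant (K r : R) :
  (0 < K)%R -> (0 < r < 1)%R -> ex_series (gauss_majorant K r).
Proof.
intros HK Hr.
assert (P := fun n => gauss_majorant_pos K r n HK (proj1 Hr)).
apply (ex_series_ext (fun n => Rabs (gauss_majorant K r n))).
{ intros n; apply Rabs_pos_eq; left; apply P. }
apply (ex_series_DAlembert _ 0%R); [lra|intros n; apply Rgt_not_eq, P|].
apply (is_lim_seq_ext (fun n => (K * r ^ n)%R)).
- intros n; simpl.
  replace (gauss_majorant K r n * (K * r ^ n) / gauss_majorant K r n)%R
    with (K * r ^ n)%R by (field; apply Rgt_not_eq, P).
  rewrite Rabs_pos_eq; [reflexivity|].
  apply Rmult_le_pos; [lra|apply pow_le; lra].
- replace 0%R with (K * 0)%R by ring.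
  apply is_lim_seq_mult'; [apply is_lim_seq_const|].
  apply is_lim_seq_geom; rewrite Rabs_pos_eq; lra.
Qed.

Lemma Cmod_le_gauss_majorant (t e : nat -> C) (K r : R) :
  (Cmod (t O) <= 1)%R -> (forall n, t (S n) = t n * e n) ->
  (forall n, (Cmod (e n) <= K * r ^ n)%R) ->
  forall n, (Cmod (t n) <= gauss_majorant K r n)%R.
Proof.
intros H0 HS He; induction n as [|n IH]; [exact H0|].
rewrite HS, Cmod_mult; simpl.
apply Rmult_le_compat; auto; apply Cmod_ge_0.
Qed.

(** * The Jacobi triple product *)

(* [(-a)^n Q^(n(n-1)/2)] *)
Fixpoint theta_term (a Q : C) (n : nat) : C :=
  match n with
  | O => 1
  | S k => theta_term a Q k * - (a * Q ^ k)
  end.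

(** The Gaussian binomial in base [Q]. The value 0 for [n] beyond [N] is imposed explicitly, because
    the truncated [N - n] would leave a spurious quotient there. *)
Definition theta_coef (Q : C) (N n : nat) : C :=
  if Nat.leb n N
  then qpoch Q Q (2 * N) / (qpoch Q Q (N - n) * qpoch Q Q (N + n))
  else 0.

Lemma theta_coef_le (Q : C) (N n : nat) : (n <= N)%nat ->
  theta_coef Q N n = qpoch Q Q (2 * N) / (qpoch Q Q (N - n) * qpoch Q Q (N + n)).
Proof. intros H; unfold theta_coef; now rewrite (proj2 (Nat.leb_le n N) H). Qed.

Lemma theta_coef_gt (Q : C) (N n : nat) : (N < n)%nat -> theta_coef Q N n = 0.
Proof. intros H; unfold theta_coef; now rewrite (proj2 (Nat.leb_gt n N) H). Qed.

Lemma one_minus_Cpow_nz (Q : C) (n : nat) : (Cmod Q < 1)%R -> 1 - Q * Q ^ n <> 0.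
Proof.
intros HQ h; apply Ceq_minus in h.
assert (E : (Cmod Q * Cmod Q ^ n = 1)%R)
  by now rewrite <- Cmod_pow, <- Cmod_mult, <- h, Cmod_1.
assert (B := Rpow_unit (Cmod Q) n (conj (Cmod_ge_0 Q) HQ)).
assert (P := Cmod_ge_0 Q); nra.
Qed.

Lemma qpoch_same_nz (Q : C) (n : nat) : (Cmod Q < 1)%R -> qpoch Q Q n <> 0.
Proof.
intros HQ; induction n as [|n IH]; simpl; [apply C1_nz|].
apply Cmult_neq_0; [exact IH|now apply one_minus_Cpow_nz].
Qed.

(** Two q-Pascal steps at once, from 2N to 2N + 2. The case split separates the places where
    coefficients on the right vanish and subtraction truncates: [N < n], [N = n], [N = n + 1], and
    the generic range. *)
Lemma theta_coef_pascal (Q : C) (N n : nat) : (Cmod Q < 1)%R ->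
  theta_coef Q (S N) (S n) =
  (1 + Q ^ (2 * N + 1)) * theta_coef Q N (S n) + Q ^ (N - n) * theta_coef Q N n
  + Q ^ (N + n + 2) * theta_coef Q N (S (S n)).
Proof.
intros HQ.
assert (nz := fun k => qpoch_same_nz Q k HQ).
assert (nf := fun k => one_minus_Cpow_nz Q k HQ).
destruct (lt_eq_lt_dec N n) as [[H|H]|H].
- rewrite !theta_coef_gt by lia; ring.
- subst n.
  rewrite (theta_coef_gt Q N (S N)), (theta_coef_gt Q N (S (S N))) by lia.
  rewrite !theta_coef_le by lia.
  rewrite !Nat.sub_diag.
  replace (S N + S N)%nat with (S (S (N + N))) by lia.
  replace (2 * S N)%nat with (S (S (N + N))) by lia.
  replace (2 * N)%nat with (N + N)%nat by lia.
  set (M := (N + N)%nat); simpl.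
  assert (h := nz M); assert (h1 := nf M); assert (h2 := nf (S M)); simpl in h2.
  field; repeat split; auto.
- destruct (le_lt_dec N (S n)) as [H'|H'].
  + replace N with (S n) in * by lia.
    rewrite (theta_coef_gt Q (S n) (S (S n))) by lia.
    rewrite !theta_coef_le by lia.
    replace (S (S n) - S n)%nat with 1%nat by lia.
    replace (S n - n)%nat with 1%nat by lia.
    rewrite !Nat.sub_diag.
    replace (2 * S (S n))%nat with (S (S (S (S (n + n))))) by lia.
    replace (S (S n) + S n)%nat with (S (S (S (n + n)))) by lia.
    replace (2 * S n)%nat with (S (S (n + n))) by lia.
    replace (S n + S n)%nat with (S (S (n + n))) by lia.
    replace (S n + n)%nat with (S (n + n)) by lia.
    replace (S (S (n + n)) + 1)%nat with (S (S (S (n + n)))) by lia.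
    set (M := (n + n)%nat); simpl.
    assert (h := nz M); assert (h0 := nf O); assert (h1 := nf M).
    assert (h2 := nf (S M)); assert (h3 := nf (S (S M))).
    simpl in *; rewrite Cmult_1_r in h0.
    set (X := Q ^ M) in *; clearbody X.
    field; repeat split; auto.
  + rewrite !theta_coef_le by lia.
    (* With N = j + n + 2 no subtraction is left; every power becomes a monomial in [Q ^ j], [Q ^ n]
       and [Q], and three symbols [qpoch] suffice. What remains is an identity of rational
       functions. *)
    destruct (Nat.le_exists_sub (S (S n)) N H') as [j [Ej _]]; subst N.
    replace (S (j + S (S n)) - S n)%nat with (S (S j)) by lia.
    replace (j + S (S n) - S n)%nat with (S j) by lia.
    replace (j + S (S n) - n)%nat with (S (S j)) by lia.
    replace (j + S (S n) - S (S n))%nat with j by lia.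
    replace (2 * S (j + S (S n)))%nat with (S (S (2 * (j + n) + 4))) by lia.
    replace (2 * (j + S (S n)))%nat with (2 * (j + n) + 4)%nat by lia.
    replace (S (j + S (S n)) + S n)%nat with (S (S (j + n + n + 2))) by lia.
    replace (j + S (S n) + S n)%nat with (S (j + n + n + 2)) by lia.
    replace (j + S (S n) + n)%nat with (j + n + n + 2)%nat by lia.
    replace (j + S (S n) + S (S n))%nat with (S (S (j + n + n + 2))) by lia.
    cbn [qpoch].
    assert (E1 : Q ^ (2 * (j + n) + 4) = Q ^ j * Q ^ j * (Q ^ n * Q ^ n) * Q ^ 4).
    { rewrite <- !Cpow_add_r; f_equal; lia. }
    assert (E2 : Q ^ (2 * (j + n) + 4 + 1) = Q ^ j * Q ^ j * (Q ^ n * Q ^ n) * Q ^ 5).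
    { rewrite <- !Cpow_add_r; f_equal; lia. }
    assert (E3 : Q ^ (j + n + n + 2) = Q ^ j * (Q ^ n * Q ^ n) * Q ^ 2).
    { rewrite <- !Cpow_add_r; f_equal; lia. }
    assert (E4 : Q ^ (j + n + n + 2 + 2) = Q ^ j * (Q ^ n * Q ^ n) * Q ^ 4).
    { rewrite <- !Cpow_add_r; f_equal; lia. }
    assert (h1 := nf j); assert (h2 := nf (S j)).
    assert (h3 := nf (j + n + n + 2)%nat); assert (h4 := nf (S (j + n + n + 2))).
    rewrite !Cpow_S in *.
    rewrite E3 in h3, h4.
    rewrite E1, E2, E3, E4.
    assert (g1 := nz j); assert (g2 := nz (j + n + n + 2)%nat).
    set (X := Q ^ j) in *; set (Y := Q ^ n) in *.
    set (P := qpoch Q Q j) in *; set (P' := qpoch Q Q (j + n + n + 2)) in *.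
    set (P'' := qpoch Q Q (2 * (j + n) + 4)).
    clearbody X Y P P' P''; clear - h1 h2 h3 h4 g1 g2.
    simpl in *; rewrite Cmult_1_r in h3, h4.
    field; repeat split; auto.
Qed.

(** The preceding relation at the central index: by the symmetry n to -n the two neighbours
    coincide, whence the factor 2. *)
Lemma theta_coef_pascal_0 (Q : C) (N : nat) : (Cmod Q < 1)%R ->
  theta_coef Q (S N) 0 =
  (1 + Q ^ (2 * N + 1)) * theta_coef Q N 0 + 2 * Q ^ (N + 1) * theta_coef Q N 1.
Proof.
intros HQ.
assert (nz := fun k => qpoch_same_nz Q k HQ).
assert (nf := fun k => one_minus_Cpow_nz Q k HQ).
destruct N as [|N].
- rewrite (theta_coef_gt Q 0 1) by lia; rewrite !theta_coef_le by lia; simpl.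
  assert (h0 := nf O); simpl in h0; rewrite Cmult_1_r in h0.
  field; repeat split; auto using C1_nz.
- rewrite !theta_coef_le by lia.
  rewrite !Nat.sub_0_r, !Nat.add_0_r.
  replace (S N - 1)%nat with N by lia.
  replace (S N + 1)%nat with (S (S N)) by lia.
  replace (2 * S (S N))%nat with (S (S (2 * N + 2))) by lia.
  replace (2 * S N)%nat with (2 * N + 2)%nat by lia.
  cbn [qpoch].
  assert (E1 : Q ^ (2 * N + 2) = Q ^ N * Q ^ N * Q ^ 2).
  { rewrite <- !Cpow_add_r; f_equal; lia. }
  assert (E2 : Q ^ (2 * N + 2 + 1) = Q ^ N * Q ^ N * Q ^ 3).
  { rewrite <- !Cpow_add_r; f_equal; lia. }
  assert (h1 := nf N); assert (h2 := nf (S N)); assert (g := nz N).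
  rewrite !Cpow_S in *; rewrite E1, E2.
  set (X := Q ^ N) in *; set (P := qpoch Q Q N) in *.
  set (P'' := qpoch Q Q (2 * N + 2)).
  clearbody X P P''; clear - h1 h2 g.
  simpl in *.
  field; repeat split; auto.
Qed.

(** Removes the truncated exponent: where [N - n] is not the true difference, the coefficient is
    0. *)
Lemma theta_coef_pow (Q : C) (N n : nat) :
  Q ^ (N - n) * Q ^ n * theta_coef Q N n = Q ^ N * theta_coef Q N n.
Proof.
destruct (le_lt_dec n N) as [H|H].
- rewrite <- Cpow_add_r; now replace (N - n + n)%nat with N by lia.
- rewrite theta_coef_gt by exact H; ring.
Qed.

(** Write c and t for coefficient and term. With Q = a b, the difference of 1 + Q^(2N+1) and (1 - a
    Q^N)(1 - b Q^N) is (a + b) Q^N. The a part pairs with the lower neighbour in the Pascal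
    relation, since Q^(N-n) c_n t_(n+1) = -a Q^N c_n t_n; the b part pairs with the upper one, since
    Q^(N+n+2) t_(n+1) = -b Q^N t_(n+2) when a is not 0. *)
Definition theta_flux (a b Q : C) (N n : nat) : C :=
  a * Q ^ N * (theta_coef Q N n * theta_term a Q n)
  - b * Q ^ N * (theta_coef Q N (S n) * theta_term a Q (S n)).

Lemma theta_flux_step (a b Q : C) (N n : nat) : (Cmod Q < 1)%R -> Q = a * b ->
  theta_coef Q (S N) (S n) * theta_term a Q (S n)
  - (1 - a * Q ^ N) * (1 - b * Q ^ N) * (theta_coef Q N (S n) * theta_term a Q (S n))
  = theta_flux a b Q N (S n) - theta_flux a b Q N n.
Proof.
intros HQ Eab; unfold theta_flux.
rewrite theta_coef_pascal by exact HQ.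
assert (E := theta_coef_pow Q N n).
replace (Q ^ (2 * N + 1)) with (a * b * (Q ^ N * Q ^ N))
  by (rewrite <- Eab, <- Cpow_add_r, <- Cpow_S; f_equal; lia).
replace (Q ^ (N + n + 2)) with (a * b * (Q * Q ^ N * Q ^ n))
  by (rewrite <- Eab, <- Cpow_S, <- Cpow_add_r, <- Cpow_S; f_equal; lia).
cbn [theta_term].
rewrite Cpow_S.
set (T := theta_term a Q n).
set (c0 := theta_coef Q N n) in *.
transitivity ((Q ^ (N - n) * Q ^ n * c0) * - (a * T)
  + T * - (a * Q ^ n) * ((a * Q ^ N + b * Q ^ N) * theta_coef Q N (S n)
      + a * b * (Q * Q ^ N * Q ^ n) * theta_coef Q N (S (S n)))).
- ring.
- rewrite E; ring.
Qed.

Lemma theta_coef_Clim (Q : C) (n : nat) : (Cmod Q < 1)%R ->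
  Clim (fun N => theta_coef Q N n) (/ qpoch_inf Q Q).
Proof.
intros HQ.
assert (nz := fun k => qpoch_same_nz Q k HQ).
assert (L := qpoch_Clim Q Q HQ).
assert (Li := Cinv_qpoch_Clim_inf Q Q HQ nz).
assert (lnz := qpoch_inf_nz Q Q HQ nz).
replace (/ qpoch_inf Q Q) with (qpoch_inf Q Q * (/ qpoch_inf Q Q * / qpoch_inf Q Q))
  by (field; exact lnz).
(* Starting at N = n avoids both the zero coefficients and the truncated subtraction. *)
apply (is_lim_seq_incr_n _ n).
change (Clim (fun N => theta_coef Q (N + n) n)
  (qpoch_inf Q Q * (/ qpoch_inf Q Q * / qpoch_inf Q Q))).
apply (Clim_ext (fun N => qpoch Q Q (2 * (N + n)) *
  (/ qpoch Q Q N * / qpoch Q Q (N + (n + n))))).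
- intros N; rewrite theta_coef_le by lia.
  replace (N + n - n)%nat with N by lia.
  replace (N + n + n)%nat with (N + (n + n))%nat by lia.
  field; auto.
- apply Clim_mult; [|apply Clim_mult; [exact Li|]].
  + apply (is_lim_seq_subseq (fun N => Cmod (qpoch Q Q N - qpoch_inf Q Q)) _
      (fun N => 2 * (N + n))%nat); [|exact L].
    apply eventually_subseq; intros; lia.
  + exact (Clim_incr_n _ _ _ Li).
Qed.

Lemma theta_coef_bounded (Q : C) : (Cmod Q < 1)%R ->
  exists B, forall N n, (Cmod (theta_coef Q N n) <= B)%R.
Proof.
intros HQ.
assert (nz := fun k => qpoch_same_nz Q k HQ).
destruct (Clim_bounded _ _ (qpoch_Clim Q Q HQ)) as [B1 H1].
destruct (Clim_bounded _ _ (Cinv_qpoch_Clim_inf Q Q HQ nz)) as [B2 H2].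
exists (B1 * (B2 * B2))%R; intros N n.
assert (P1 : (0 <= B1)%R) by (eapply Rle_trans; [apply Cmod_ge_0|apply (H1 O)]).
assert (P2 : (0 <= B2)%R) by (eapply Rle_trans; [apply Cmod_ge_0|apply (H2 O)]).
destruct (le_lt_dec n N) as [H|H].
- rewrite theta_coef_le by exact H.
  replace (qpoch Q Q (2 * N) / (qpoch Q Q (N - n) * qpoch Q Q (N + n)))
    with (qpoch Q Q (2 * N) * (/ qpoch Q Q (N - n) * / qpoch Q Q (N + n)))
    by (field; auto).
  rewrite !Cmod_mult.
  apply Rmult_le_compat; [apply Cmod_ge_0| |apply H1|].
  + apply Rmult_le_pos; apply Cmod_ge_0.
  + apply Rmult_le_compat; try apply Cmod_ge_0; apply H2.
- rewrite theta_coef_gt, Cmod_0 by exact H.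
  apply Rmult_le_pos; [|apply Rmult_le_pos]; assumption.
Qed.

Lemma theta_term_majorant (a Q : C) (n : nat) :
  (Cmod (theta_term a Q n) <= gauss_majorant (Cmod a) (Cmod Q) n)%R.
Proof.
apply (Cmod_le_gauss_majorant _ (fun k => - (a * Q ^ k))).
- simpl; rewrite Cmod_1; apply Rle_refl.
- reflexivity.
- intros k; rewrite Cmod_opp, Cmod_mult, Cmod_pow; apply Rle_refl.
Qed.

Lemma ex_series_gauss_majorant_S (B K r : R) :
  (0 < K)%R -> (0 < r < 1)%R -> ex_series (fun n => B * gauss_majorant K r (S n))%R.
Proof.
intros HK Hr.
apply (@ex_series_scal R_AbsRing R_NormedModule B).
apply (ex_series_incr_1 (gauss_majorant K r)).
now apply ex_series_gauss_majorant.
Qed.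

(** The finite sums are treated as infinite series with finitely many nonzero terms, the form to
    which dominated convergence applies. Choice turns their values into a sequence in [N]. *)
Lemma finite_theta_series (a Q : C) (B : R) :
  (0 < Cmod Q < 1)%R -> a <> 0 ->
  (forall N n, (Cmod (theta_coef Q N n) <= B)%R) ->
  exists r : nat -> C, forall N,
    is_Cseries (fun n => theta_coef Q N (S n) * theta_term a Q (S n)) (r N).
Proof.
intros HQ Ha HB; 
apply (functional_choice (fun N l =>
  is_Cseries (fun n => theta_coef Q N (S n) * theta_term a Q (S n)) l)).
intros N; apply ex_series_Cmod.
apply (@ex_series_le R_AbsRing R_CompleteNormedModule _
  (fun n => (B * gauss_majorant (Cmod a) (Cmod Q) (S n))%R)).
- intros n.
  change (Rabs (Cmod (theta_coef Q N (S n) * theta_term a Q (S n))) <=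
    B * gauss_majorant (Cmod a) (Cmod Q) (S n))%R.
  rewrite Rabs_pos_eq, Cmod_mult by apply Cmod_ge_0.
  apply Rmult_le_compat; try apply Cmod_ge_0; [apply HB|apply theta_term_majorant].
- apply ex_series_gauss_majorant_S; [now apply Cmod_gt_0|exact HQ].
Qed.

Lemma theta_flux_Clim (a b Q : C) (N : nat) : Clim (theta_flux a b Q N) 0.
Proof.
apply (is_lim_seq_ext_loc (fun _ => 0%R)); [|apply is_lim_seq_const].
exists (S N); intros n Hn; unfold theta_flux.
rewrite !theta_coef_gt by lia.
transitivity (Cmod 0); [symmetry; apply Cmod_0|f_equal; ring].
Qed.

Lemma finite_theta_series_step (a b Q r r' : C) (N : nat) :
  (Cmod Q < 1)%R -> Q = a * b ->
  is_Cseries (fun n => theta_coef Q N (S n) * theta_term a Q (S n)) r ->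
  is_Cseries (fun n => theta_coef Q (S N) (S n) * theta_term a Q (S n)) r' ->
  r' = (1 - a * Q ^ N) * (1 - b * Q ^ N) * r
       - (a * Q ^ N * theta_coef Q N 0 + Q ^ (N + 1) * theta_coef Q N 1).
Proof.
intros HQ Eab Hr Hr'.
assert (H1 := is_Cseries_telescope _ _ _
  (fun n => theta_flux_step a b Q N n HQ Eab) (theta_flux_Clim a b Q N)).
assert (H2 := @is_series_minus C_AbsRing C_NormedModule _ _ _ _ Hr'
  (@is_series_scal C_AbsRing C_NormedModule
     ((1 - a * Q ^ N) * (1 - b * Q ^ N)) _ _ Hr)).
assert (E : r' - (1 - a * Q ^ N) * (1 - b * Q ^ N) * r = 0 - theta_flux a b Q N 0)
  by exact (is_Cseries_unique _ _ _ H2 H1).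
replace r' with ((r' - (1 - a * Q ^ N) * (1 - b * Q ^ N) * r)
  + (1 - a * Q ^ N) * (1 - b * Q ^ N) * r) by ring.
rewrite E; unfold theta_flux; simpl theta_term.
replace (Q ^ (N + 1)) with (a * b * Q ^ N)
  by (rewrite <- Eab, <- Cpow_S; f_equal; lia).
ring.
Qed.

(** Induction on [N]: the central Pascal relation and the boundary terms of the two halves add up to
    (1 - a Q^N)(1 - b Q^N) times the old central coefficient, the terms in [theta_coef Q N 1]
    cancelling. *)
Lemma finite_triple_product (a b Q : C) (ra rb : nat -> C) :
  (Cmod Q < 1)%R -> Q = a * b ->
  (forall N, is_Cseries (fun n => theta_coef Q N (S n) * theta_term a Q (S n)) (ra N)) ->
  (forall N, is_Cseries (fun n => theta_coef Q N (S n) * theta_term b Q (S n)) (rb N)) ->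
  forall N, theta_coef Q N 0 + ra N + rb N = qpoch a Q N * qpoch b Q N.
Proof.
intros HQ Eab Ha Hb; assert (Eba : Q = b * a) by (rewrite Eab; ring).
induction N as [|N IH].
- assert (Z : forall c r : C, is_Cseries
    (fun n => theta_coef Q 0 (S n) * theta_term c Q (S n)) r -> r = 0).
  { intros c r H.
    rewrite (is_Cseries_unique _ _ (0 - 0) H); [ring|].
    apply (is_Cseries_telescope _ (fun _ => RtoC 0)); [|apply Clim_const].
    intros n; rewrite theta_coef_gt by lia; ring. }
  rewrite (Z _ _ (Ha O)), (Z _ _ (Hb O)), theta_coef_le by lia.
  simpl; field; apply C1_nz.
- rewrite (finite_theta_series_step a b Q _ _ N HQ Eab (Ha N) (Ha (S N))).
  rewrite (finite_theta_series_step b a Q _ _ N HQ Eba (Hb N) (Hb (S N))).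
  rewrite theta_coef_pascal_0 by exact HQ.
  cbn [qpoch].
  transitivity ((1 - a * Q ^ N) * (1 - b * Q ^ N) * (qpoch a Q N * qpoch b Q N));
    [|ring].
  rewrite <- IH.
  replace (Q ^ (2 * N + 1)) with (a * b * (Q ^ N * Q ^ N))
    by (rewrite <- Eab, <- Cpow_add_r, <- Cpow_S; f_equal; lia).
  ring.
Qed.

Lemma jacobi_triple_product (a b Q sa sb : C) :
  (0 < Cmod Q < 1)%R -> Q = a * b ->
  is_Cseries (fun n => theta_term a Q (S n)) sa ->
  is_Cseries (fun n => theta_term b Q (S n)) sb ->
  1 + sa + sb = qpoch_inf a Q * qpoch_inf b Q * qpoch_inf Q Q.
Proof.
intros HQ Eab Hsa Hsb.
assert (Qnz : Q <> 0) by now apply Cmod_gt_0.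
assert (anz : a <> 0) by (intros h; apply Qnz; rewrite Eab, h; ring).
assert (bnz : b <> 0) by (intros h; apply Qnz; rewrite Eab, h; ring).
assert (lnz := qpoch_inf_nz Q Q (proj2 HQ) (fun k => qpoch_same_nz Q k (proj2 HQ))).
destruct (theta_coef_bounded Q (proj2 HQ)) as [B HB].
assert (D : forall (c s : C) (r : nat -> C), c <> 0 -> is_Cseries (fun n => theta_term c Q (S n)) s ->
  (forall N, is_Cseries (fun n => theta_coef Q N (S n) * theta_term c Q (S n)) (r N)) ->
  Clim r (/ qpoch_inf Q Q * s)).
{ intros c s r cnz Hs Hr.
  apply (series_dominated_convergence
    (fun N n => theta_coef Q N (S n) * theta_term c Q (S n))
    (fun n => / qpoch_inf Q Q * theta_term c Q (S n)) _ _
    (fun n => (B * gauss_majorant (Cmod c) (Cmod Q) (S n))%R)); [| | |exact Hr|].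
  - intros N n; rewrite Cmod_mult.
    apply Rmult_le_compat; try apply Cmod_ge_0; [apply HB|apply theta_term_majorant].
  - apply ex_series_gauss_majorant_S; [now apply Cmod_gt_0|exact HQ].
  - intros n; apply Clim_mult; [apply theta_coef_Clim, HQ|apply Clim_const].
  - exact (@is_series_scal C_AbsRing C_NormedModule (/ qpoch_inf Q Q) _ _ Hs). }
destruct (finite_theta_series a Q B HQ anz HB) as [ra Ha].
destruct (finite_theta_series b Q B HQ bnz HB) as [rb Hb].
assert (L := Clim_plus _ _ _ _ (Clim_plus _ _ _ _ (theta_coef_Clim Q 0 (proj2 HQ))
  (D a sa ra anz Hsa Ha)) (D b sb rb bnz Hsb Hb)).
apply (Clim_ext _ _ _ (finite_triple_product a b Q ra rb (proj2 HQ) Eab Ha Hb)) in L.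
assert (E := Clim_unique _ _ _ L (Clim_mult _ _ _ _
  (qpoch_Clim a Q (proj2 HQ)) (qpoch_Clim b Q (proj2 HQ)))).
(* In the limit all coefficients equal 1/(Q;Q)_oo; clearing it produces the third product. *)
rewrite <- E; field; exact lnz.
Qed.

(** * The bilateral sum *)

(* The [n]-th summand of the theorem with [x = x0], [q = x0 x1]; taking [x = x1]
   instead gives the summand of index [-n]. *)
Fixpoint bterm (x q u : C) (n : nat) : C :=
  match n with
  | O => 1
  | S k => bterm x q u k * (q ^ k * x * (u - x * q ^ k) / (1 - u * x * q ^ k))
  end.

(** Since u q - x q^(k+1) = q (u - x q^k), the numerators at u q match those at u one index later,
    leaving u q - x unmatched. The denominators overlap except for one factor at the start and two
    at the end. *)
Lemma bterm_shift (x q u : C) (n : nat) :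
  (forall k, qpoch (u * x) q k <> 0) ->
  bterm x q (u * q) (S n) = bterm x q u n *
    (q ^ n * x * (q ^ n * (u * q - x)) * (1 - u * x)
     / ((1 - u * x * q ^ n) * (1 - u * x * q ^ S n))).
Proof.
intros Hnz; assert (nf := fun k => qpoch_factor_nz _ _ k Hnz).
induction n as [|n IH].
- assert (h0 := nf O); assert (h1 := nf 1%nat); simpl in *.
  rewrite Cmult_1_r in h0; rewrite Cmult_1_r in h1.
  field; repeat split; auto.
- change (bterm x q (u * q) (S (S n))) with (bterm x q (u * q) (S n) *
    (q ^ S n * x * (u * q - x * q ^ S n) / (1 - u * q * x * q ^ S n))).
  rewrite IH; cbn [bterm].
  assert (h0 := nf n); assert (h1 := nf (S n)); assert (h2 := nf (S (S n))).
  rewrite !Cpow_S in *.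
  set (X := q ^ n) in *; set (T := bterm x q u n); clearbody X T.
  field; repeat split; auto.
Qed.

(** A telescoping certificate: a rational multiple of [bterm x q u n]. As both terms of index n + 1
    are also rational multiples of it, [bflux_step] reduces to an identity of rational functions. *)
Definition bflux (x y q u : C) (n : nat) : C :=
  - u * (1 - u * x) * (1 - u * y) * (q ^ n * x) / (1 - u * x * q ^ n) * bterm x q u n.

Lemma bflux_step (x y q u : C) (n : nat) :
  q = x * y -> (forall k, qpoch (u * x) q k <> 0) ->
  (1 - u * x) * (1 - u * y) * bterm x q u (S n)
  - (1 - u ^ 2 * q) * bterm x q (u * q) (S n)
  = bflux x y q u (S n) - bflux x y q u n.
Proof.
intros Eq Hnz; rewrite bterm_shift by exact Hnz; unfold bflux; cbn [bterm].
assert (nf := fun k => qpoch_factor_nz _ _ k Hnz).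
assert (h0 := nf n); assert (h1 := nf (S n)).
rewrite !Cpow_S in *.
set (X := q ^ n) in *; set (T := bterm x q u n); clearbody X T; subst q.
field; repeat split; auto.
Qed.

(** One [K] serves all [m]: the denominators at u q^m are 1 - u x q^(m+k), all bounded below by the
    same [d], and the numerator u q^m - x q^k has modulus at most |u| + |x|. *)
Lemma bterm_majorant (x q u : C) :
  x <> 0 -> (Cmod q < 1)%R -> (forall k, qpoch (u * x) q k <> 0) ->
  exists K, (0 < K)%R /\ forall m n,
    (Cmod (bterm x q (u * q ^ m) n) <= gauss_majorant K (Cmod q) n)%R.
Proof.
intros Hx Hq Hnz.
destruct (qpoch_factor_lower_bound _ _ Hq Hnz) as [d [d0 Hd]].
assert (nf := fun k => qpoch_factor_nz _ _ k Hnz).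
assert (x0 : (0 < Cmod x)%R) by now apply Cmod_gt_0.
assert (u0 := Cmod_ge_0 u).
exists (Cmod x * (Cmod u + Cmod x) / d)%R; split.
{ apply Rdiv_lt_0_compat; [apply Rmult_lt_0_compat; lra|exact d0]. }
intros m.
apply (Cmod_le_gauss_majorant _ (fun k => q ^ k * x * (u * q ^ m - x * q ^ k)
  / (1 - u * q ^ m * x * q ^ k))).
- simpl; rewrite Cmod_1; apply Rle_refl.
- reflexivity.
- intros k.
  replace (u * q ^ m * x * q ^ k) with (u * x * q ^ (m + k))
    by (rewrite Cpow_add_r; ring).
  rewrite Cmod_div by apply nf.
  replace (Cmod x * (Cmod u + Cmod x) / d * Cmod q ^ k)%R
    with (Cmod q ^ k * Cmod x * (Cmod u + Cmod x) / d)%R by (field; lra).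
  rewrite !Cmod_mult, Cmod_pow; unfold Rdiv.
  assert (P := fun j => Rpow_unit (Cmod q) j (conj (Cmod_ge_0 q) Hq)).
  assert (Pk : (0 <= Cmod q ^ k * Cmod x)%R)
    by (apply Rmult_le_pos; [apply P|apply Cmod_ge_0]).
  apply Rmult_le_compat.
  + apply Rmult_le_pos; [exact Pk|apply Cmod_ge_0].
  + left; apply Rinv_0_lt_compat, Cmod_gt_0, nf.
  + apply Rmult_le_compat_l; [exact Pk|].
    unfold Cminus; eapply Rle_trans; [apply Cmod_triangle|].
    rewrite Cmod_opp, !Cmod_mult, !Cmod_pow.
    assert (Pm := P m); assert (Pk' := P k); nra.
  + apply Rinv_le_contravar; [exact d0|apply Hd].
Qed.

Lemma bterm_Clim_0 (x q u : C) (n : nat) :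
  (Cmod q < 1)%R -> (forall k, qpoch (u * x) q k <> 0) ->
  Clim (fun m => bterm x q (u * q ^ m) n) (bterm x q 0 n).
Proof.
intros Hq Hnz.
assert (nf := fun k => qpoch_factor_nz _ _ k Hnz).
assert (Lu : Clim (fun m => u * q ^ m) 0).
{ rewrite <- (Cmult_0_r u); apply Clim_mult; [apply Clim_const|now apply Cpow_Clim_0]. }
induction n as [|n IH]; [exact (Clim_const 1)|].
cbn [bterm]; apply Clim_mult; [exact IH|].
apply Clim_mult.
- apply Clim_mult; [apply Clim_const|].
  apply Clim_minus; [exact Lu|apply Clim_const].
- apply Clim_inv.
  + intros m; replace (u * q ^ m * x * q ^ n) with (u * x * q ^ (m + n))
      by (rewrite Cpow_add_r; ring); apply nf.
  + replace (1 - 0 * x * q ^ n) with (RtoC 1) by ring; apply C1_nz.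
  + apply Clim_minus; [apply Clim_const|].
    apply Clim_mult; [|apply Clim_const].
    apply Clim_mult; [exact Lu|apply Clim_const].
Qed.

Lemma bterm_0 (x q : C) (n : nat) : bterm x q 0 n = theta_term (x ^ 2) (q ^ 2) n.
Proof.
induction n as [|n IH]; [reflexivity|].
cbn [bterm theta_term]; rewrite IH, <- Cpow_mult_r, (Nat.mul_comm 2), Cpow_mult_r.
replace (1 - 0 * x * q ^ n) with (RtoC 1) by ring.
simpl; field; apply C1_nz.
Qed.

Lemma ex_series_bterm (x q u : C) :
  x <> 0 -> (0 < Cmod q < 1)%R -> (forall k, qpoch (u * x) q k <> 0) ->
  ex_series (fun n => Cmod (bterm x q u n)).
Proof.
intros Hx Hq Hnz.
destruct (bterm_majorant x q u Hx (proj2 Hq) Hnz) as [K [K0 HK]].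
apply (@ex_series_le R_AbsRing R_CompleteNormedModule _ (gauss_majorant K (Cmod q)));
  [|now apply ex_series_gauss_majorant].
intros n; change (Rabs (Cmod (bterm x q u n)) <= gauss_majorant K (Cmod q) n)%R.
rewrite Rabs_pos_eq by apply Cmod_ge_0.
assert (H := HK O n); simpl in H; now rewrite Cmult_1_r in H.
Qed.

Lemma bterm_series (x q u : C) :
  x <> 0 -> (0 < Cmod q < 1)%R -> (forall k, qpoch (u * x) q k <> 0) ->
  exists l : C, is_Cseries (fun n => bterm x q u (S n)) l.
Proof.
intros Hx Hq Hnz; apply ex_series_Cmod.
apply (ex_series_incr_1 (fun n => Cmod (bterm x q u n))).
now apply ex_series_bterm.
Qed.

Lemma bflux_Clim (x y q u : C) :
  x <> 0 -> (0 < Cmod q < 1)%R -> (forall k, qpoch (u * x) q k <> 0) ->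
  Clim (bflux x y q u) 0.
Proof.
intros Hx Hq Hnz.
assert (nf := fun k => qpoch_factor_nz _ _ k Hnz).
assert (Lq := Cpow_Clim_0 q (proj2 Hq)).
assert (LT : Clim (bterm x q u) 0).
{ apply (Clim_squeeze _ _ (fun n => Cmod (bterm x q u n))).
  - intros n; right; f_equal; ring.
  - now apply (ex_series_lim_0 (fun n => Cmod (bterm x q u n))), ex_series_bterm. }
replace (RtoC 0) with
  (- u * (1 - u * x) * (1 - u * y) * (0 * x) * / (1 - u * x * 0) * 0) by ring.
apply Clim_mult; [|exact LT].
apply Clim_mult.
- apply Clim_mult; [apply Clim_const|].
  apply Clim_mult; [exact Lq|apply Clim_const].
- apply Clim_inv; [exact nf| |].
  + replace (1 - u * x * 0) with (RtoC 1) by ring; apply C1_nz.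
  + apply Clim_minus; [apply Clim_const|].
    apply Clim_mult; [apply Clim_const|exact Lq].
Qed.

(** The flux vanishes at infinity, so the inhomogeneous term is minus its value at index 0. *)
Lemma bterm_series_shift (x y q u r r' : C) :
  x <> 0 -> (0 < Cmod q < 1)%R -> q = x * y -> (forall k, qpoch (u * x) q k <> 0) ->
  is_Cseries (fun n => bterm x q u (S n)) r ->
  is_Cseries (fun n => bterm x q (u * q) (S n)) r' ->
  (1 - u * x) * (1 - u * y) * r = (1 - u ^ 2 * q) * r' + u * x * (1 - u * y).
Proof.
intros Hx Hq Eq Hnz Hr Hr'.
assert (H1 := is_Cseries_telescope _ _ _
  (fun n => bflux_step x y q u n Eq Hnz) (bflux_Clim x y q u Hx Hq Hnz)).
assert (H2 := @is_series_minus C_AbsRing C_NormedModule _ _ _ _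
  (@is_series_scal C_AbsRing C_NormedModule ((1 - u * x) * (1 - u * y)) _ _ Hr)
  (@is_series_scal C_AbsRing C_NormedModule (1 - u ^ 2 * q) _ _ Hr')).
assert (E : (1 - u * x) * (1 - u * y) * r - (1 - u ^ 2 * q) * r'
  = 0 - bflux x y q u 0) by exact (is_Cseries_unique _ _ _ H2 H1).
replace ((1 - u * x) * (1 - u * y) * r) with
  ((1 - u * x) * (1 - u * y) * r - (1 - u ^ 2 * q) * r' + (1 - u ^ 2 * q) * r') by ring.
rewrite E; unfold bflux; simpl.
assert (h := qpoch_factor_nz _ _ 0 Hnz); simpl in h.
field; intros g; apply h; rewrite <- g; ring.
Qed.

(** Carries the nonvanishing of denominators from u to every u q^m. *)
Lemma qpoch_shift_nz (a b : C) (m : nat) :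
  (forall k, qpoch a b k <> 0) -> forall k, qpoch (a * b ^ m) b k <> 0.
Proof.
intros H; induction k as [|k IH]; simpl; [apply C1_nz|].
apply Cmult_neq_0; [exact IH|].
rewrite <- Cmult_assoc, <- Cpow_add_r; now apply qpoch_factor_nz.
Qed.

Lemma bilateral_iterate (x y q u : C) (rx ry : nat -> C) :
  x <> 0 -> y <> 0 -> (0 < Cmod q < 1)%R -> q = x * y ->
  (forall k, qpoch (u * x) q k <> 0) -> (forall k, qpoch (u * y) q k <> 0) ->
  (forall m, is_Cseries (fun n => bterm x q (u * q ^ m) (S n)) (rx m)) ->
  (forall m, is_Cseries (fun n => bterm y q (u * q ^ m) (S n)) (ry m)) ->
  forall m, qpoch (u * x) q m * qpoch (u * y) q m * (1 + rx O + ry O)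
    = qpoch (u ^ 2 * q) (q ^ 2) m * (1 + rx m + ry m).
Proof.
intros Hx Hy Hq Eq Hnx Hny Rx Ry; induction m as [|m IH]; [simpl; ring|].
set (v := u * q ^ m).
assert (Ev : u * q ^ S m = v * q) by (unfold v; simpl; ring).
assert (Sx := Rx (S m)); assert (Sy := Ry (S m)); rewrite Ev in Sx, Sy.
assert (Nx : forall k, qpoch (v * x) q k <> 0).
{ replace (v * x) with (u * x * q ^ m) by (unfold v; ring); now apply qpoch_shift_nz. }
assert (Ny : forall k, qpoch (v * y) q k <> 0).
{ replace (v * y) with (u * y * q ^ m) by (unfold v; ring); now apply qpoch_shift_nz. }
assert (Ex := bterm_series_shift x y q v _ _ Hx Hq Eq Nx (Rx m) Sx).
assert (Eq' : q = y * x) by (rewrite Eq; ring).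
assert (Ey := bterm_series_shift y x q v _ _ Hy Hq Eq' Ny (Ry m) Sy).
cbn [qpoch].
transitivity ((qpoch (u * x) q m * qpoch (u * y) q m * (1 + rx O + ry O))
  * ((1 - v * x) * (1 - v * y))); [unfold v; ring|].
rewrite IH.
transitivity (qpoch (u ^ 2 * q) (q ^ 2) m * ((1 - v * x) * (1 - v * y)
  + (1 - v * x) * (1 - v * y) * rx m + (1 - v * y) * (1 - v * x) * ry m)); [ring|].
rewrite Ex, Ey.
replace (u ^ 2 * q * (q ^ 2) ^ m) with (v ^ 2 * q)
  by (unfold v; rewrite <- Cpow_mult_r, (Nat.mul_comm 2), Cpow_mult_r; simpl; ring).
(* The boundary terms of both halves and the central 1 recombine into 1 - v^2 q, the next factor in
   base q^2. *)
set (A := qpoch (u ^ 2 * q) (q ^ 2) m); clearbody A v; rewrite Eq; ring.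
Qed.

Lemma bilateral_sum (x y q u rx ry : C) :
  x <> 0 -> y <> 0 -> (0 < Cmod q < 1)%R -> q = x * y ->
  (forall k, qpoch (u * x) q k <> 0) -> (forall k, qpoch (u * y) q k <> 0) ->
  is_Cseries (fun n => bterm x q u (S n)) rx ->
  is_Cseries (fun n => bterm y q u (S n)) ry ->
  1 + rx + ry =
  qpoch_inf (u ^ 2 * q) (q ^ 2) * qpoch_inf (x ^ 2) (q ^ 2) * qpoch_inf (y ^ 2) (q ^ 2)
  * qpoch_inf (q ^ 2) (q ^ 2) / (qpoch_inf (u * x) q * qpoch_inf (u * y) q).
Proof.
intros Hx Hy Hq Eq Hnx Hny Rx Ry.
assert (Hq2 : (0 < Cmod (q ^ 2) < 1)%R) by (rewrite Cmod_pow; simpl; nra).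
assert (D : forall z : C, z <> 0 -> (forall k, qpoch (u * z) q k <> 0) ->
  exists (r : nat -> C) (s : C),
    (forall m, is_Cseries (fun n => bterm z q (u * q ^ m) (S n)) (r m)) /\
    is_Cseries (fun n => theta_term (z ^ 2) (q ^ 2) (S n)) s /\ Clim r s).
{ intros z Hz Hnz.
  (* At u = 0 every denominator is 1, so the limiting half series falls under the same lemmas. *)
  assert (Hz0 : forall k, qpoch (0 * z) q k <> 0).
  { intros k; replace (qpoch (0 * z) q k) with (RtoC 1); [apply C1_nz|].
    induction k as [|k IH]; simpl; [reflexivity|rewrite <- IH; ring]. }
  destruct (functional_choice (fun m l =>
    is_Cseries (fun n => bterm z q (u * q ^ m) (S n)) l)) as [r Hr].
  { intros m; apply bterm_series; auto.
    replace (u * q ^ m * z) with (u * z * q ^ m) by ring; now apply qpoch_shift_nz. }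
  destruct (bterm_series z q 0 Hz Hq Hz0) as [s Hs].
  destruct (bterm_majorant z q u Hz (proj2 Hq) Hnz) as [K [K0 HK]].
  exists r, s; split; [exact Hr|split].
  - apply (is_series_ext _ _ _ (fun n => bterm_0 z q (S n)) Hs).
  - apply (series_dominated_convergence _ _ r s
      (fun n => gauss_majorant K (Cmod q) (S n)) (fun m n => HK m (S n))) with (4 := Hs).
    + apply (ex_series_incr_1 (gauss_majorant K (Cmod q))).
      now apply ex_series_gauss_majorant.
    + intros n; now apply bterm_Clim_0.
    + exact Hr. }
destruct (D x Hx Hnx) as [px [tx [Px [Tx Lx]]]].
destruct (D y Hy Hny) as [py [ty [Py [Ty Ly]]]].
assert (E1 := bilateral_iterate x y q u px py Hx Hy Hq Eq Hnx Hny Px Py).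
replace (px O) with rx in E1.
2:{ apply (is_Cseries_unique _ _ _ Rx).
    assert (H := Px O); simpl in H; now rewrite Cmult_1_r in H. }
replace (py O) with ry in E1.
2:{ apply (is_Cseries_unique _ _ _ Ry).
    assert (H := Py O); simpl in H; now rewrite Cmult_1_r in H. }
assert (EQ : q ^ 2 = x ^ 2 * y ^ 2) by (rewrite Eq; apply Cpow_mult_l).
assert (J := jacobi_triple_product _ _ _ _ _ Hq2 EQ Tx Ty).
assert (L1 := Clim_mult _ _ _ _
  (Clim_mult _ _ _ _ (qpoch_Clim (u * x) q (proj2 Hq)) (qpoch_Clim (u * y) q (proj2 Hq)))
  (Clim_const (1 + rx + ry))).
assert (L2 := Clim_mult _ _ _ _ (qpoch_Clim (u ^ 2 * q) (q ^ 2) (proj2 Hq2))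
  (Clim_plus _ _ _ _ (Clim_plus _ _ _ _ (Clim_const 1) Lx) Ly)).
assert (E := Clim_unique _ _ _ (Clim_ext _ _ _ E1 L1) L2).
rewrite J in E.
assert (nx := qpoch_inf_nz _ _ (proj2 Hq) Hnx).
assert (ny := qpoch_inf_nz _ _ (proj2 Hq) Hny).
replace (1 + rx + ry) with
  (qpoch_inf (u * x) q * qpoch_inf (u * y) q * (1 + rx + ry)
   / (qpoch_inf (u * x) q * qpoch_inf (u * y) q)) by (field; auto).
rewrite E; field; auto.
Qed.

(** * The summands over the integers and their product form *)

Lemma Cpowz_of_nat (z : C) (n : nat) : Cpowz z (Z.of_nat n) = z ^ n.
Proof.
destruct n as [|n]; [reflexivity|].
simpl; now rewrite SuccNat2Pos.id_succ.
Qed.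

(** Exponent of x0 at index n; that of x1 is [triangular (n - 1)], where the truncated predecessor
    of 0 still gives the right exponent 0. *)
Definition triangular (n : nat) : nat := (n * (n + 1) / 2)%nat.

Lemma triangular_S (n : nat) : triangular (S n) = (triangular n + S n)%nat.
Proof.
unfold triangular; rewrite <- Nat.div_add by lia; f_equal; lia.
Qed.

Lemma Z_triangular (n : nat) :
  (Z.of_nat n * (Z.of_nat n + 1) / 2)%Z = Z.of_nat (triangular n).
Proof. unfold triangular; rewrite Nat2Z.inj_div; f_equal; lia. Qed.

Lemma Z_triangular_pred (n : nat) :
  (Z.of_nat n * (Z.of_nat n - 1) / 2)%Z = Z.of_nat (triangular (n - 1)).
Proof.
destruct n as [|n]; [reflexivity|].
rewrite <- Z_triangular; f_equal; lia.
Qed.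

(** From n to n + 1 the monomial gains u x^(n+1) y^n = u x q^n, and this u clears the inverse in 1 -
    x q^n / u. *)
Lemma bterm_closed_form (x y u : C) (n : nat) :
  u <> 0 -> (forall k, qpoch (u * x) (x * y) k <> 0) ->
  u ^ n * x ^ triangular n * y ^ triangular (n - 1)
  * (qpoch (/ u * x) (x * y) n / qpoch (u * x) (x * y) n) = bterm x (x * y) u n.
Proof.
intros Hu Hnz; induction n as [|n IH].
- simpl; field; apply C1_nz.
- cbn [bterm]; rewrite <- IH.
  assert (h := qpoch_factor_nz _ _ n Hnz); assert (g := Hnz n).
  cbn [qpoch]; rewrite triangular_S, Cpow_add_r.
  replace (triangular (S n - 1)) with (triangular (n - 1) + n)%nat.
  2:{ destruct n as [|n]; [reflexivity|].
      replace (S (S n) - 1)%nat with (S n) by lia; rewrite triangular_S.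
      now replace (S n - 1)%nat with n by lia. }
  rewrite Cpow_add_r, !Cpow_S.
  replace (y ^ n * x ^ n) with ((x * y) ^ n) by (rewrite Cpow_mult_l; ring).
  rewrite !Cpow_mult_l in *.
  field; repeat split; auto.
Qed.

Lemma summand_nonneg (x0 x1 u : C) (n : nat) :
  u <> 0 -> (forall k, qpoch (u * x0) (x0 * x1) k <> 0) ->
  Cpowz u (Z.of_nat n) * Cpowz x0 (Z.of_nat n * (Z.of_nat n + 1) / 2)%Z
  * Cpowz x1 (Z.of_nat n * (Z.of_nat n - 1) / 2)%Z
  * qpoch_quot (/ u * x0) (u * x0) (x0 * x1) (Z.of_nat n) = bterm x0 (x0 * x1) u n.
Proof.
intros Hu Hnz.
rewrite Z_triangular, Z_triangular_pred, !Cpowz_of_nat.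
rewrite <- bterm_closed_form by assumption; f_equal.
destruct n as [|n].
- simpl; field; apply C1_nz.
- change (Z.of_nat (S n)) with (Zpos (Pos.of_succ_nat n)); unfold qpoch_quot.
  now rewrite SuccNat2Pos.id_succ.
Qed.

(** At z = -N the products z(z + 1) and z(z - 1) are N(N - 1) and N(N + 1), so the exponents of x0
    and x1 swap; the cancelled quotient supplies u^(2N), which turns u^(-N) into u^N. This is the
    summand of index N with x0 and x1 exchanged. *)
Lemma summand_neg (x0 x1 u : C) (n : nat) :
  x0 <> 0 -> u <> 0 -> (forall k, qpoch (u * x1) (x0 * x1) k <> 0) ->
  let z := (- Z.of_nat (S n))%Z in
  Cpowz u z * Cpowz x0 (z * (z + 1) / 2)%Z * Cpowz x1 (z * (z - 1) / 2)%Z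
  * qpoch_quot (/ u * x0) (u * x0) (x0 * x1) z = bterm x1 (x0 * x1) u (S n).
Proof.
intros Hx0 Hu Hnz z; rewrite (Cmult_comm x0) in *.
rewrite <- bterm_closed_form by assumption.
replace (z * (z + 1))%Z with (Z.of_nat (S n) * (Z.of_nat (S n) - 1))%Z by lia.
replace (z * (z - 1))%Z with (Z.of_nat (S n) * (Z.of_nat (S n) + 1))%Z by lia.
rewrite Z_triangular, Z_triangular_pred, !Cpowz_of_nat.
unfold z; change (- Z.of_nat (S n))%Z with (Zneg (Pos.of_succ_nat n)).
rewrite (Cmult_comm x1), qpoch_quot_neg, (Cmult_comm x0) by assumption.
unfold Cpowz; rewrite SuccNat2Pos.id_succ, (Nat.mul_comm 2), Cpow_mult_r.
assert (U : u ^ S n <> 0) by now apply Cpow_nz.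
assert (g := Hnz (S n)).
set (A := qpoch (u * x1) (x1 * x0) (S n)) in *; clearbody A.
set (U' := u ^ S n) in *; clearbody U'.
field; split; assumption.
Qed.

Theorem corollary6p2 (x0 x1 u : C) (hx0 : x0 <> 0) (hx1 : x1 <> 0) (hu : u <> 0)
    (hb : (Cmod (x0 * x1) < 1)%R)
    (hd0 : forall n : nat, qpoch (u * x0) (x0 * x1) n <> 0)
    (hd1 : forall n : nat, qpoch (u * x1) (x0 * x1) n <> 0) :
  is_seriesZ
    (fun n : Z =>
       Cpowz u n * Cpowz x0 (n * (n + 1) / 2)%Z * Cpowz x1 (n * (n - 1) / 2)%Z
       * qpoch_quot (/ u * x0) (u * x0) (x0 * x1) n)
    (qpoch_inf (u ^ 2 * (x0 * x1)) ((x0 * x1) ^ 2)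
     * qpoch_inf (x0 ^ 2) ((x0 * x1) ^ 2)
     * qpoch_inf (x1 ^ 2) ((x0 * x1) ^ 2)
     * qpoch_inf ((x0 * x1) ^ 2) ((x0 * x1) ^ 2)
     / (qpoch_inf (u * x0) (x0 * x1) * qpoch_inf (u * x1) (x0 * x1))).
Proof.
assert (hq : (0 < Cmod (x0 * x1) < 1)%R).
{ split; [|exact hb]; apply Cmod_gt_0; now apply Cmult_neq_0. }
assert (P := fun n => summand_nonneg x0 x1 u n hu hd0).
assert (N := fun n => summand_neg x0 x1 u n hx0 hu hd1).
destruct (bterm_series x0 _ u hx0 hq hd0) as [r0 R0].
destruct (bterm_series x1 _ u hx1 hq hd1) as [r1 R1].
split; [|split].
- apply (ex_series_ext (fun n => Cmod (bterm x0 (x0 * x1) u n))).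
  + intros n; now rewrite P.
  + now apply ex_series_bterm.
- apply (ex_series_ext (fun n => Cmod (bterm x1 (x0 * x1) u (S n)))).
  + intros n; now rewrite N.
  + apply (ex_series_incr_1 (fun n => Cmod (bterm x1 (x0 * x1) u n))).
    now apply ex_series_bterm.
- exists (1 + r0), r1; split; [|split].
  + apply (is_series_ext (bterm x0 (x0 * x1) u)); [intros n; now rewrite P|].
    (* [r0] sums from index 1 on; the central summand 1 is assigned to the nonnegative half. *)
    apply is_series_decr_1.
    refine (eq_ind r0 (fun l => is_Cseries _ l) R0 _ _).
    change (r0 = 1 + r0 + - (1)); ring.
  + apply (is_series_ext (fun n => bterm x1 (x0 * x1) u (S n))); [|exact R1].
    intros n; now rewrite N.
  + symmetry; now apply bilateral_sum.
Qed.
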